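(* Let $n\ge1$ and $1\le k\le n$. For each $w\in\mathcal A(n,k)$ the word $\alpha(w)$ lies in $\mathcal R(n,k)$ and $w\le\alpha(w)$ in $\Pi(n,k)$, and $\Pi(n,k)$ is the disjoint union of the intervals $$\Pi(n,k)=\bigsqcup_{w\in\mathcal A(n,k)}[w,\alpha(w)].$$ Moreover, if $w\in\mathcal A(n,k)$ satisfies $q^{A(w)}(1+q)^{B(w)}=q^i(1+q)^j$, then $w$ has rank $i$ in $\Pi(n,k)$ and the interval $[w,\alpha(w)]$ is isomorphic to the Boolean algebra of all subsets of a $j$-element set.
   Context: An RG-word of length $n$ with maximum letter $k$ is a word $w=w_1\cdots w_n$ of positive integers with $w_1=1$, $w_i\le\max(w_1,\dots,w_{i-1})+1$ for $2\le i\le n$, and $\max_i w_i=k$; $\mathcal R(n,k)$ denotes their set. $w$ is allowable if every even letter of $w$ occurs exactly once; $\mathcal A(n,k)\subseteq\mathcal R(n,k)$ is the set of allowable words. With $m_i=\max(w_1,\dots,w_i)$, let $A(w)=\sum_{i=2}^n A_i(w)$, $B(w)=\sum_{i=2}^nB_i(w)$ where $A_i(w)=w_i-1$ if $m_{i-1}\ge w_i$ and $0$ otherwise, and $B_i(w)=1$ if $m_{i-1}>w_i$ and $0$ otherwise. The Stirling poset of the second kind $\Pi(n,k)$ is the partial order on $\mathcal R(n,k)$ generated by the cover relations $v\lessdot w$ whenever $w$ is obtained from $v$ by increasing exactly one entry by $1$. It is graded, the rank of $w$ being $\sum_{i=1}^n w_i-n-\binom{k}{2}$. For $w\in\mathcal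 A(n,k)$ let $\mathrm{Inv}(w)=\{i: w_j>w_i\text{ for some } j<i\}$, and let $\alpha(w)$ be the word obtained from $w$ by adding $1$ to each entry $w_i$ with $i\in\mathrm{Inv}(w)$. *)

(* Defs.v *)
From Stdlib Require Import Relation_Operators.
From mathcomp Require Import all_boot all_order all_algebra.
From mathcomp Require Import classical_sets functions.

Set Implicit Arguments.
Unset Strict Implicit.
Unset Printing Implicit Defensive.

Local Open Scope classical_set_scope.
Local Open Scope nat_scope.

(* A word w_1 ... w_n is the sequence of its letters; positions are 0-based,
   so the letter w_(p+1) is [nth 0 w p]. *)
Notation word := (seq nat).

(* m_p = max(w_1, ..., w_p), with m_0 = 0. *)
Definition prefix_max (w : word) (p : nat) : nat := \max_(x <- take p w) x.

Definition RG (n k : nat) : set word :=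
  [set w | [/\ size w = n,
               forall x, x \in w -> 0 < x,
               nth 0 w 0 = 1,
               forall p, 1 <= p < n -> nth 0 w p <= (prefix_max w p).+1
             & \max_(x <- w) x = k]].

Definition allowable (n k : nat) : set word :=
  [set w | RG n k w /\
           forall x, x \in w -> ~~ odd x -> count_mem x w = 1].

Definition statA (w : word) : nat :=
  \sum_(1 <= p < size w)
     (if nth 0 w p <= prefix_max w p then nth 0 w p - 1 else 0).

Definition statB (w : word) : nat :=
  \sum_(1 <= p < size w) (if nth 0 w p < prefix_max w p then 1 else 0).

Definition Pi_cover (n k : nat) (v w : word) : Prop :=
  [/\ RG n k v, RG n k w
    & exists2 p, p < size v & w = set_nth 0 v p (nth 0 v p).+1].

(* Only meaningful on RG n k; outside of it the relation is just equality. *)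
Definition Pi_le (n k : nat) : word -> word -> Prop :=
  clos_refl_trans word (Pi_cover n k).

Definition Pi_itv (n k : nat) (v w : word) : set word :=
  [set x | [/\ RG n k x, Pi_le n k v x & Pi_le n k x w]].

Definition Pi_minimal (n k : nat) : set word :=
  [set w | RG n k w /\ forall v, RG n k v -> Pi_le n k v w -> v = w].

Definition rank_function (n k : nat) (rho : word -> nat) : Prop :=
  (forall w, Pi_minimal n k w -> rho w = 0) /\
  (forall v w, Pi_cover n k v w -> rho w = (rho v).+1).

(* The values of a rank function on RG n k are uniquely determined, since every
   element lies above a minimal one; explicitly, on RG n k the rank function is
   w |-> sumn w - n - 'C(k, 2). *)
Definition has_rank (n k : nat) (w : word) (i : nat) : Prop :=
  RG n k w /\ exists2 rho, rank_function n k rho & rho w = i.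

Definition is_inv (w : word) (p : nat) : bool :=
  has (fun y => nth 0 w p < y) (take p w).

Definition alpha (w : word) : word :=
  mkseq (fun p => if is_inv w p then (nth 0 w p).+1 else nth 0 w p) (size w).

(* The subset I of RG n k, with the order induced by Pi_le n k, is isomorphic
   to the lattice of all subsets of 'I_j. *)
Definition iso_Boolean (n k : nat) (I : set word) (j : nat) : Prop :=
  exists2 f : word -> {set 'I_j},
    set_bij I setT f &
    forall x y, I x -> I y -> (Pi_le n k x y <-> f x \subset f y).

(* Main.v *)
(** The order of [Pi n k] is the pointwise order, and changing a non-record
    letter without exceeding the preceding maximum leaves all prefix maxima
    unchanged.  Lowering by 1 every even letter that is not a record sends
    an arbitrary [v] to an allowable word [w]; the lowered positions are
    inversions of [w], so [v] is [w] plus the indicator of a subset of the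
    inversions.  Conversely the repeated letters of an allowable word are odd,
    so raising any set of inversions creates exactly even non-records, and
    lowering undoes it.  For the rank, summing the letters of an RG-word along
    prefixes gives [sumn w = statA w + n + 'C(k, 2)], whence [statA] is a rank
    function. *)

Require Import Defs.
From Stdlib Require Import Relation_Operators.
From mathcomp Require Import all_boot all_order all_algebra.
From mathcomp Require Import classical_sets functions.
From mathcomp Require Import zify.

Set Implicit Arguments.
Unset Strict Implicit.
Unset Printing Implicit Defensive.

Import GRing.Theory.
Local Open Scope classical_set_scope.
Local Open Scope nat_scope.

(** * Prefix maxima *)

Lemma prefix_max0 w : prefix_max w 0 = 0.
Proof. by rewrite /prefix_max take0 big_nil. Qed.

Lemma prefix_maxS w p :
  prefix_max w p.+1 = maxn (prefix_max w p) (nth 0 w p).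
Proof.
rewrite /prefix_max; case: (ltnP p (size w)) => hp.
  by rewrite (take_nth 0 hp) -cats1 big_cat big_seq1.
by rewrite nth_default // maxn0 !take_oversize // (leq_trans hp).
Qed.

Lemma prefix_max_size w : prefix_max w (size w) = \max_(x <- w) x.
Proof. by rewrite /prefix_max take_size. Qed.

Lemma leq_prefix_max w p q : p <= q -> prefix_max w p <= prefix_max w q.
Proof.
elim: q => [|q IH]; first by rewrite leqn0 => /eqP ->.
rewrite leq_eqVlt => /predU1P[-> //|/IH h].
by rewrite prefix_maxS leq_max h.
Qed.

Lemma nth_leq_prefix_max w p q : p < q -> nth 0 w p <= prefix_max w q.
Proof.
by move=> /(leq_prefix_max w); apply: leq_trans; rewrite prefix_maxS leq_maxr.
Qed.

Lemma leq_prefix_max_word v u p :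
  (forall q, q < p -> nth 0 v q <= nth 0 u q) ->
  prefix_max v p <= prefix_max u p.
Proof.
elim: p => [|p IH] vu; first by rewrite !prefix_max0.
rewrite !prefix_maxS; have := vu p (leqnn _).
by have := IH (fun q hq => vu q (leqW hq)); lia.
Qed.

(** Induction on the prefix: the maxima agree so far, so only the effect of the next letter on them
    matters. Letters may thus differ freely below the running maximum. *)
Lemma eq_prefix_max v u :
  (forall p, prefix_max v p = prefix_max u p ->
     maxn (prefix_max u p) (nth 0 v p) = maxn (prefix_max u p) (nth 0 u p)) ->
  prefix_max v =1 prefix_max u.
Proof.
move=> vu; elim=> [|p IH]; first by rewrite !prefix_max0.
by rewrite !prefix_maxS IH vu.
Qed.

Lemma is_invE w p : is_inv w p = (nth 0 w p < prefix_max w p).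
Proof.
rewrite /is_inv /prefix_max; elim: (take p w) => [|x s IH].
  by rewrite big_nil ltn0.
by rewrite big_cons /= leq_max IH.
Qed.

(** * RG-words in terms of prefix maxima *)

Section RGWords.

Variables n k : nat.
Hypothesis n_gt0 : 0 < n.

(** Since [prefix_max w 0 = 0], the bounds at [p = 0] already force the first letter to be 1, so one
    condition covers all positions. *)
Lemma RGP w :
  RG n k w <-> [/\ size w = n,
                   forall p, p < n -> 0 < nth 0 w p <= (prefix_max w p).+1
                 & prefix_max w n = k].
Proof.
split=> [[sz pos w0 step mx]|[sz step mx]].
  split=> // [p hp|]; last by rewrite -sz prefix_max_size.
  rewrite pos ?mem_nth ?sz //=.
  by case: p hp => [|p] hp; [rewrite w0 | apply: step].
split=> //.
- by move=> x /(nthP 0)[p]; rewrite sz => /step/andP[h _] <-.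
- by have := step 0 n_gt0; rewrite prefix_max0; lia.
- by move=> p /andP[_ /step/andP[]].
- by rewrite -prefix_max_size sz.
Qed.

Lemma RG_nth w p : RG n k w -> p < n -> 0 < nth 0 w p <= (prefix_max w p).+1.
Proof. by case/RGP=> _ + _; apply. Qed.

Lemma RG_same_max v x :
  RG n k v -> size x = n -> prefix_max x =1 prefix_max v ->
  (forall p, p < n -> 0 < nth 0 x p <= (prefix_max v p).+1) -> RG n k x.
Proof.
case/RGP=> _ _ vk sz mx step; apply/RGP; split=> // [p /step|]; rewrite mx //.
Qed.

(** Running maxima grow by at most 1 per letter, so no value up to the current maximum is
    skipped. *)
Lemma RG_mem_take w p x :
  RG n k w -> p <= n -> 0 < x <= prefix_max w p -> x \in take p w.
Proof.
move=> Rw; elim: p => [|p IH] hp; first by rewrite prefix_max0; case: x.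
have szw : size w = n by case: Rw.
rewrite prefix_maxS (take_nth 0) ?szw // mem_rcons inE => hx.
have := RG_nth Rw hp.
have [hxp|hxp] := leqP x (prefix_max w p).
  by rewrite IH ?orbT //; lia.
by move=> ?; apply/orP; left; apply/eqP; lia.
Qed.

(** * The rank function *)

(** A non-record letter [x] splits as [(x - 1) + 1]; a record over the maximum [m] is [m + 1], where
    [m] is the increment from ['C(m, 2)] to ['C(m.+1, 2)]. *)
Lemma RG_sum_prefix w p :
  RG n k w -> 0 < p <= n ->
  \sum_(0 <= q < p) nth 0 w q =
  \sum_(1 <= q < p) (if nth 0 w q <= prefix_max w q then nth 0 w q - 1 else 0)
  + p + 'C(prefix_max w p, 2).
Proof.
move=> Rw; elim: p => // -[_ _|p IH /andP[_ hp]].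
  have := RG_nth Rw n_gt0.
  rewrite big_nat1 big_geq // prefix_maxS prefix_max0 max0n.
  by case: (nth 0 w 0) => [|[|]].
rewrite big_nat_recr // IH; last exact: ltnW.
rewrite [in RHS]big_nat_recr // [prefix_max w p.+2]prefix_maxS.
have := RG_nth Rw hp.
case: (leqP (nth 0 w p.+1) (prefix_max w p.+1)) => h /=; first lia.
move=> hw; have {h hw}-> : nth 0 w p.+1 = (prefix_max w p.+1).+1 by lia.
by rewrite binS bin1; lia.
Qed.

Lemma RG_sumn w : RG n k w -> sumn w = statA w + n + 'C(k, 2).
Proof.
move=> Rw; have [szw _ mx] := iffLR (RGP w) Rw.
by rewrite sumnE (big_nth 0) szw RG_sum_prefix ?n_gt0 ?leqnn // mx /statA szw.
Qed.

Lemma Pi_cover_statA v w : Pi_cover n k v w -> statA w = (statA v).+1.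
Proof.
case=> Rv Rw [p hp Dw]; have := RG_sumn Rv; have := RG_sumn Rw.
by rewrite {1}Dw sumn_set_nth_ltn //; lia.
Qed.

Lemma Pi_minimal_statA w : Pi_minimal n k w -> statA w = 0.
Proof.
case=> Rw minw; have szw : size w = n by case: Rw.
rewrite /statA big_nat big1 // => p /andP[p_gt0]; rewrite szw => hp.
case: ifP => // hwp; apply/eqP; rewrite -leqn0 leqNgt subn_gt0; apply/negP=> h1.
(* A non-record letter greater than 1 can be lowered without changing any prefix maximum, which
   contradicts minimality. *)
pose v := set_nth 0 w p (nth 0 w p).-1.
have nv q : nth 0 v q = if q == p then (nth 0 w p).-1 else nth 0 w q.
  by rewrite nth_set_nth.
have szv : size v = n by rewrite size_set_nth szw; apply/maxn_idPr.
have Rv : RG n k v.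
  apply: (RG_same_max Rw) => // [|q hq].
    apply: eq_prefix_max => q _; rewrite nv; case: eqP => // ->; lia.
  rewrite nv; have := RG_nth Rw hq; case: eqP => [->|//]; lia.
have Dw : w = set_nth 0 v p (nth 0 v p).+1.
  apply: (@eq_from_nth _ 0) => [|q _].
    by rewrite size_set_nth szv szw; apply/esym/maxn_idPr.
  by rewrite nth_set_nth /= !nv eqxx; case: eqP => // ->; rewrite prednK // ltnW.
have /(congr1 (nth 0 ^~ p)) : v = w.
  by apply: minw => //; apply: rt_step; split=> //; exists p; rewrite ?szv.
by rewrite nv eqxx; lia.
Qed.

Lemma RG_has_rank w : RG n k w -> has_rank n k w (statA w).
Proof.
move=> Rw; split=> //; exists statA => //.
by split; [exact: Pi_minimal_statA | exact: Pi_cover_statA].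
Qed.

(** * The order is pointwise *)

Lemma Pi_le_nth v u : Pi_le n k v u -> forall p, nth 0 v p <= nth 0 u p.
Proof.
elim=> {v u} [v u [_ _ [q _ ->]] p|//|x y z _ h _ h' p].
  by rewrite nth_set_nth /=; case: eqP => // ->.
exact: leq_trans (h p) (h' p).
Qed.

Lemma leq_sumn (v u : word) :
  size v = size u -> (forall p, nth 0 v p <= nth 0 u p) -> sumn v <= sumn u.
Proof. by move=> sz vu; rewrite !sumnE (big_nth 0) [leqRHS](big_nth 0) sz leq_sum. Qed.

(* Raising the leftmost letter at which [v] and [u] differ stays in [RG n k]:
   to its left the two words agree, and [u] bounds the new letter. *)
Lemma Pi_leP v u : RG n k v -> RG n k u ->
  Pi_le n k v u <-> forall p, nth 0 v p <= nth 0 u p.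
Proof.
move=> Rv Ru; split=> [/Pi_le_nth//|vu]; have [szu _ mu] := iffLR (RGP u) Ru.
have [d] := ubnP (sumn u - sumn v).
elim: d => // d IH in v Rv vu * => hd; have [szv _ mv] := iffLR (RGP v) Rv.
have [->|neq] := eqVneq v u; first exact: rt_refl.
have /ex_minnP[p /andP[hp hvu] minp] :
    exists p, (p < n) && (nth 0 v p < nth 0 u p).
  have /existsP[p hp] : [exists p : 'I_n, nth 0 v p < nth 0 u p].
    apply: contraNT neq; rewrite negb_exists => /forallP eqvu.
    apply/eqP/(@eq_from_nth _ 0); rewrite szv ?szu // => p hp.
    by have := eqvu (Ordinal hp); have := vu p; rewrite /=; lia.
  by exists p; rewrite ltn_ord.
pose x := set_nth 0 v p (nth 0 v p).+1.
have nx q : nth 0 x q = if q == p then (nth 0 v p).+1 else nth 0 v q.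
  by rewrite nth_set_nth.
have szx : size x = n by rewrite size_set_nth szv; apply/maxn_idPr.
have vx q : nth 0 v q <= nth 0 x q by rewrite nx; case: eqP => // ->.
have xu q : nth 0 x q <= nth 0 u q by rewrite nx; case: eqP => // ->.
have mvx q : prefix_max v q <= prefix_max x q by apply: leq_prefix_max_word.
have Rx : RG n k x.
  apply/RGP; split=> // [q hq|].
    have := RG_nth Rv hq; have := mvx q; rewrite nx.
    case: eqP => [->|_]; last lia.
    have : prefix_max u p <= prefix_max v p.
      apply: leq_prefix_max_word => r hr; rewrite leqNgt; apply/negP => hvr.
      by have := minp r; rewrite hvr (ltn_trans hr) // => /(_ isT); lia.
    by have := RG_nth Ru hp; have := mvx p; lia.
  (* The maximum of [x] is squeezed between those of [v] and [u], both equal to [k]. *)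
  apply/eqP; rewrite eqn_leq -{1}mu leq_prefix_max_word //=.
  by rewrite -mv mvx.
apply: (rt_trans _ _ _ x).
  by apply: rt_step; split=> //; exists p; rewrite ?szv.
apply: IH => //; have := leq_sumn (etrans szx (esym szu)) xu.
by rewrite /x sumn_set_nth_ltn ?szv //; lia.
Qed.

(** * Allowable words *)

(** The value of a non-record letter has already occurred, by [RG_mem_take]. Conversely, a record
    differs from all earlier letters, and a later copy of it would be an even non-record. *)
Lemma allowableP w : RG n k w ->
  allowable n k w <->
  forall p, p < n -> ~~ odd (nth 0 w p) -> prefix_max w p < nth 0 w p.
Proof.
move=> Rw; have szw : size w = n by case: Rw.
have count_split p : p < n -> count_mem (nth 0 w p) w =
    count_mem (nth 0 w p) (take p w) + (count_mem (nth 0 w p) (drop p.+1 w)).+1.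
  move=> hp; set x := nth 0 w p.
  rewrite -[in LHS](cat_take_drop p w) count_cat.
  by rewrite (drop_nth 0) ?szw //= -/x eqxx.
split=> [[_ aw] p hp ev|aw].
  rewrite ltnNge; apply/negP => hle.
  have /andP[wp_gt0 _] := RG_nth Rw hp.
  have := RG_mem_take Rw (ltnW hp) (introT andP (conj wp_gt0 hle)).
  have wp : nth 0 w p \in w by rewrite mem_nth ?szw.
  have := aw _ wp ev.
  by rewrite count_split // -has_pred1 has_count; lia.
split=> // x /(nthP 0)[p]; rewrite szw => hp <- ev; rewrite count_split //.
have /count_memPn -> : nth 0 w p \notin take p w.
  apply/negP => /(nthP 0)[q]; rewrite size_take szw hp => hq.
  rewrite nth_take // => Dq; have := nth_leq_prefix_max w hq.
  by rewrite Dq leqNgt aw.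
suff /count_memPn -> : nth 0 w p \notin drop p.+1 w by [].
apply/negP => /(nthP 0)[q]; rewrite size_drop szw => hq; rewrite nth_drop => Dq.
have pq : p < p.+1 + q by rewrite leq_addr.
have := nth_leq_prefix_max w pq; rewrite -{1}Dq leqNgt aw ?Dq //; lia.
Qed.

Lemma allowable_odd w p :
  allowable n k w -> p < n -> nth 0 w p <= prefix_max w p -> odd (nth 0 w p).
Proof.
move=> Aw hp; apply: contraTT => ev; rewrite -ltnNge.
by case: (Aw) => Rw _; apply: (iffLR (allowableP Rw)).
Qed.

(** * The words between [w] and [alpha w] *)

(** The factor [p < size w] matters: past the end the default letter 0 can count as an inversion. *)
Lemma nth_alpha w p : nth 0 (alpha w) p = nth 0 w p + is_inv w p * (p < size w).
Proof.
case: (ltnP p (size w)) => hp; last first.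
  by rewrite !nth_default ?size_mkseq // muln0.
by rewrite nth_mkseq // muln1; case: is_inv; lia.
Qed.

Lemma prefix_max_alpha w : prefix_max (alpha w) =1 prefix_max w.
Proof.
apply: eq_prefix_max => p _; rewrite nth_alpha is_invE.
by case: (ltnP (nth 0 w p)); case: (p < size w); lia.
Qed.

Lemma prefix_max_le_alpha w x :
  (forall p, nth 0 w p <= nth 0 x p) ->
  (forall p, nth 0 x p <= nth 0 (alpha w) p) ->
  prefix_max x =1 prefix_max w.
Proof.
move=> wx xa p; apply/eqP; rewrite eqn_leq.
by rewrite -{1}(prefix_max_alpha w) !leq_prefix_max_word.
Qed.

Lemma RG_alpha w : RG n k w -> RG n k (alpha w).
Proof.
move=> Rw; have szw : size w = n by case: Rw.
apply: (RG_same_max Rw); rewrite ?size_mkseq //; first exact: prefix_max_alpha.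
move=> p hp; have := RG_nth Rw hp; rewrite nth_alpha is_invE szw hp.
by case: ltnP; lia.
Qed.

Lemma Pi_le_alpha w : RG n k w -> Pi_le n k w (alpha w).
Proof.
move=> Rw; apply/(Pi_leP Rw (RG_alpha Rw)) => p.
by rewrite nth_alpha leq_addr.
Qed.

(** Membership in [RG n k] comes for free, because a word squeezed between [w] and [alpha w] has
    their common prefix maxima. The interval is therefore a full product of chains of one or two
    elements. *)
Lemma Pi_itv_alphaP w x : RG n k w ->
  Pi_itv n k w (alpha w) x <->
  size x = n /\
  forall p, nth 0 w p <= nth 0 x p <= nth 0 w p + is_inv w p * (p < n).
Proof.
move=> Rw; have szw : size w = n by case: Rw.
split=> [[Rx /Pi_le_nth wx /Pi_le_nth xa]|[szx wxa]].
  split=> [|p]; first by case: Rx.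
  by rewrite wx -szw -nth_alpha xa.
have wx p : nth 0 w p <= nth 0 x p by case/andP: (wxa p).
have xa p : nth 0 x p <= nth 0 (alpha w) p.
  by rewrite nth_alpha szw; case/andP: (wxa p).
have mx := prefix_max_le_alpha wx xa.
have Rx : RG n k x.
  apply: (RG_same_max Rw) => // p hp.
  have := RG_nth Rw hp; have := RG_nth (RG_alpha Rw) hp.
  by rewrite prefix_max_alpha; have := wx p; have := xa p; lia.
by split=> //; apply/Pi_leP => //; apply: RG_alpha.
Qed.

(** * The projection onto allowable words *)

Definition lower_even (v : word) : word :=
  mkseq (fun p => nth 0 v p - (~~ odd (nth 0 v p) && (nth 0 v p <= prefix_max v p)))
        (size v).

Lemma nth_lower_even v p : nth 0 (lower_even v) p =
  nth 0 v p - (~~ odd (nth 0 v p) && (nth 0 v p <= prefix_max v p)).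
Proof.
case: (ltnP p (size v)) => hp; first by rewrite nth_mkseq.
(* The default letter 0 is even, but truncated subtraction keeps it at 0. *)
by rewrite !nth_default ?size_mkseq.
Qed.

Lemma prefix_max_lower_even v : prefix_max (lower_even v) =1 prefix_max v.
Proof.
apply: eq_prefix_max => p _; rewrite nth_lower_even.
by case: leqP; case: odd => /=; lia.
Qed.

Lemma RG_lower_even v : RG n k v -> RG n k (lower_even v).
Proof.
move=> Rv; apply: (RG_same_max Rv).
- by rewrite size_mkseq; case: Rv.
- exact: prefix_max_lower_even.
move=> p hp; have := RG_nth Rv hp; rewrite nth_lower_even.
(* A positive even letter is at least 2, so lowering it keeps it positive. *)
by case: (nth 0 v p) => [|[|m]] //=; lia.
Qed.

(** Lowered letters become odd, and an even letter left alone is a record. *)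
Lemma allowable_lower_even v : RG n k v -> allowable n k (lower_even v).
Proof.
move=> Rv; apply/(allowableP (RG_lower_even Rv)) => p hp.
have := RG_nth Rv hp; rewrite prefix_max_lower_even nth_lower_even.
by case: leqP; case: (boolP (odd _)) => /=; lia.
Qed.

Lemma Pi_itv_lower_even v :
  RG n k v -> Pi_itv n k (lower_even v) (alpha (lower_even v)) v.
Proof.
move=> Rv; apply/(Pi_itv_alphaP _ (RG_lower_even Rv)).
have szv : size v = n by case: Rv.
split=> // p; rewrite is_invE prefix_max_lower_even nth_lower_even.
case: (ltnP p n) => hp; last by rewrite (nth_default _ (_ : size v <= p)) ?szv.
by have := RG_nth Rv hp; case: leqP; case: (odd _) => /=; lia.
Qed.

(** This recovers [w] from any word of its interval, so the intervals are disjoint. *)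
Lemma lower_even_Pi_itv w x :
  allowable n k w -> Pi_itv n k w (alpha w) x -> lower_even x = w.
Proof.
move=> Aw; have Rw : RG n k w by case: Aw.
have szw : size w = n by case: Rw.
move=> Ix; have [szx wxa] := iffLR (Pi_itv_alphaP x Rw) Ix.
have mx : prefix_max x =1 prefix_max w.
  by case: Ix => _ /Pi_le_nth wx /Pi_le_nth; apply: prefix_max_le_alpha.
apply: (@eq_from_nth _ 0); rewrite size_mkseq szx ?szw // => p hp.
rewrite nth_lower_even mx; have := wxa p; rewrite is_invE hp muln1.
have := @allowable_odd w p Aw hp; have [inv|ninv] := ltnP.
  (* At an inversion [w] has an odd letter: unraised it is left alone; raised it is an even
     non-record and gets lowered back. *)
  move=> /(_ (ltnW inv)) odd_w hx.
  have [->|->] : nth 0 x p = nth 0 w p \/ nth 0 x p = (nth 0 w p).+1 by lia.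
    by rewrite odd_w subn0.
  by rewrite /= odd_w inv subn1.
(* Elsewhere [x] agrees with [w], and the letter is an odd non-record or a record; neither is
   lowered. *)
rewrite addn0 => odd_w /anti_leq <-.
by case: leqP => [/odd_w ->|]; rewrite ?andbF subn0.
Qed.

(** * The Boolean structure of the intervals *)

Definition inversions (w : word) : seq nat :=
  [seq p <- iota 0 (size w) | is_inv w p].

Lemma inversions_uniq w : uniq (inversions w).
Proof. exact/filter_uniq/iota_uniq. Qed.

Lemma mem_inversions w p : (p \in inversions w) = is_inv w p && (p < size w).
Proof. by rewrite mem_filter mem_iota. Qed.

Lemma size_inversions w : 0 < size w -> size (inversions w) = statB w.
Proof.
move=> w_gt0; rewrite size_filter -sum1_count big_mkcond /= /statB.
rewrite -[in iota 0 _](subn0 (size w)) -/(index_iota 0 (size w)) big_ltn //.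
(* Position 0 is never an inversion, which matches the sum in [statB] starting at 1. *)
rewrite is_invE prefix_max0 ltn0 add0n.
by apply: eq_bigr => p _; rewrite is_invE.
Qed.

Lemma iso_Boolean_Pi_itv w :
  RG n k w -> iso_Boolean n k (Pi_itv n k w (alpha w)) (statB w).
Proof.
move=> Rw; have szw : size w = n by case: Rw.
pose s := inversions w; have szs : size s = statB w.
  by apply: size_inversions; rewrite szw.
have s_inv (i : 'I_(statB w)) : is_inv w (nth 0 s i) * (nth 0 s i < n) = 1.
  have : nth 0 s i \in s by rewrite mem_nth // szs.
  by rewrite mem_inversions szw => /andP[-> ->].
have s_index p : is_inv w p * (p < n) != 0 ->
    exists i : 'I_(statB w), nth 0 s i = p.
  rewrite muln_eq0 !eqb0 negb_or !negbK -szw -mem_inversions => sp.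
  have hi : index p s < statB w by rewrite -szs index_mem.
  by exists (Ordinal hi); rewrite /= nth_index.
(* [f x] records which inversions of [w] are raised in [x], numbered by their place in [s]. *)
pose f (x : word) : {set 'I_(statB w)} :=
  [set i : 'I_(statB w) | nth 0 w (nth 0 s i) < nth 0 x (nth 0 s i)]%SET.
(* Used twice: for injectivity of [f] through antisymmetry, and for the reflection of the order. *)
have le_f x y : Pi_itv n k w (alpha w) x -> Pi_itv n k w (alpha w) y ->
    f x \subset f y -> forall p, nth 0 x p <= nth 0 y p.
  move=> /(Pi_itv_alphaP _ Rw)[_ wx] /(Pi_itv_alphaP _ Rw)[_ wy] /fintype.subsetP fxy p.
  have := wx p; have := wy p.
  case: (eqVneq (is_inv w p * (p < n)) 0) => [->|]; first lia.
  move=> /[dup] inv /s_index[i Dp].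
  have := fxy i; rewrite !inE Dp; case: ltnP => [_ /(_ isT)|]; last lia.
  have -> : is_inv w p * (p < n) = 1 by rewrite -Dp s_inv.
  lia.
exists f.
  split=> //.
    move=> x y /set_mem Ix /set_mem Iy fxy.
    apply: (@eq_from_nth _ 0) => [|p _].
      by case: Ix Iy => [[-> _ _ _ _] _ _] [[-> _ _ _ _] _ _].
    by apply/anti_leq; rewrite !le_f ?fxy.
  move=> S _.
  (* The preimage of [S] raises exactly the inversions numbered by [S]. *)
  pose x := mkseq (fun p => nth 0 w p + [exists i in S, nth 0 s i == p]) n.
  have nx p : nth 0 x p = nth 0 w p + [exists i in S, nth 0 s i == p].
    case: (ltnP p n) => hp; first by rewrite nth_mkseq.
    rewrite !nth_default ?size_mkseq ?szw //.
    case: existsP => // -[i /andP[_ /eqP Dp]].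
    by have := s_inv i; rewrite Dp ltnNge hp muln0.
  exists x.
    apply/(Pi_itv_alphaP _ Rw); rewrite size_mkseq; split=> // p.
    rewrite nx leq_addr leq_add2l /=.
    by case: existsP => // -[i /andP[_ /eqP <-]]; rewrite s_inv.
  apply/setP => i; rewrite inE nx -{1}[nth 0 w _]addn0 ltn_add2l lt0b.
  apply/existsP/idP => [[j /andP[Sj]]|Si]; last by exists i; rewrite Si eqxx.
  by rewrite nth_uniq ?szs ?inversions_uniq // => /eqP/val_inj <-.
move=> x y Ix Iy; have [[Rx _ _] [Ry _ _]] := (Ix, Iy).
split=> [/(Pi_leP Rx Ry) xy|fxy]; last by apply/(Pi_leP Rx Ry)/le_f.
by apply/fintype.subsetP => i; rewrite !inE => /leq_trans; apply.
Qed.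

End RGWords.

(* Evaluating at 1 isolates the exponent of [1 + 'X], then evaluating at 2 that
   of ['X]. *)
Lemma expX_exp1X_inj (a b i j : nat) :
  ('X^a * (1 + 'X) ^+ b = 'X^i * (1 + 'X) ^+ j :> {poly int})%R ->
  a = i /\ b = j.
Proof.
move=> E.
have ev (m c d : nat) : (('X^c * (1 + 'X) ^+ d).[m%:R] =
    (m ^ c * m.+1 ^ d)%N%:R :> int)%R.
  by rewrite !hornerE natrM !natrX -nat1r.
have {}E m : m ^ a * m.+1 ^ b = m ^ i * m.+1 ^ j.
  by have := congr1 (horner^~ m%:R)%R E; rewrite !ev => /eqP; rewrite Num.Theory.eqr_nat => /eqP.
have bj : b = j by have := E 1; rewrite !exp1n !mul1n => /expnI ->.
split=> //; have := E 2; rewrite bj => /eqP.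
by rewrite eqn_pmul2r ?expn_gt0 // => /eqP/expnI ->.
Qed.

Theorem theorem5p1 (n k : nat) (hn : 1 <= n) (hk : 1 <= k <= n) :
  [/\ forall w, allowable n k w ->
        RG n k (alpha w) /\ Pi_le n k w (alpha w),
      RG n k = \bigcup_(w in allowable n k) Pi_itv n k w (alpha w),
      trivIset (allowable n k) (fun w => Pi_itv n k w (alpha w))
    & forall (w : word) (i j : nat), allowable n k w ->
        ('X^(statA w) * (1 + 'X) ^+ statB w =
           'X^i * (1 + 'X) ^+ j :> {poly int})%R ->
        has_rank n k w i /\ iso_Boolean n k (Pi_itv n k w (alpha w)) j].
Proof.
split.
- by move=> w [Rw _]; split; [exact: RG_alpha | exact: Pi_le_alpha].
- apply/seteqP; split=> [v Rv|v [w _ []] //].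
  by exists (lower_even v); [exact: allowable_lower_even|exact: Pi_itv_lower_even].
- move=> u v Au Av [x [Iu Iv]].
  (* A common word [x] of two intervals gives [lower_even x] as the bottom of both. *)
  by rewrite -(lower_even_Pi_itv hn Au Iu) (lower_even_Pi_itv hn Av Iv).
- move=> w i j [Rw _] /expX_exp1X_inj[<- <-].
  by split; [exact: RG_has_rank | exact: iso_Boolean_Pi_itv].
Qed.
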